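(* Let $g_1:\mathbb{R}^d\to[0,\infty)$ be differentiable almost everywhere, let $U$ be a $d\times d$ orthogonal matrix, and define $g_2(\bm z)=g_1(U\bm z)$. Assume that for each of $g_1,g_2$ the optimal drift equation $\nabla g(\bm z)/g(\bm z)=\bm z$ has a unique solution. Let $g_1^{\mathrm I},g_2^{\mathrm I}$ be the integrands obtained by applying optimal drift importance sampling to $g_1,g_2$. Then there is an orthogonal matrix $V$ with $g_2^{\mathrm I}(\bm z)=g_1^{\mathrm I}(V\bm z)$ for all $\bm z$; consequently $g_1$ and $g_2$ have the same IS-active subspaces, and their analytic expressions in the $d$-dimensional IS-active subspace coincide: $g_1^{\mathrm{IA}}(\bm z)=g_2^{\mathrm{IA}}(\bm z)$.
   Context: Optimal drift importance sampling: for a nonnegative $g$, the optimal drift $\bm\mu^*$ is the (assumed unique) solution of $\nabla g(\bm z)/g(\bm z)=\bm z$, and the IS integrand is $g^{\mathrm I}(\bm z)=g(\bm z+\bm\mu^* )\exp\!\big(-{\bm\mu^*}^T\bm z-\tfrac12{\bm\mu^*}^T\bm\mu^*\big)$, so that $\mathbb{E}g(\bm Z)=\mathbb{E}g^{\mathrm I}(\bm Z)$ for $\bm Z\sim N(\bm 0,I_d)$. For an a.e. differentiable $h$, the gradient information matrix is $C=\mathbb{E}\big(\nabla h(\bm Z)\nabla h(\bm Z)^T\big)=Q\Lambda Q^T$ (eigendecomposition, $Q$ orthogonal, eigenvalues descending); the $r$-dimensional active subspace of $h$ is spanned by the first $r$ columns of $Q$. The IS-active subspaces of $g$ are the active subspaces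 of $g^{\mathrm I}$, and $g^{\mathrm{IA}}(\bm z):=g^{\mathrm I}(Q\bm z)$ with $Q$ the eigenvector matrix of the gradient information matrix of $g^{\mathrm I}$. Two functions related by $h_2(\bm z)=h_1(V\bm z)$, $V$ orthogonal, are said to have the same active subspaces when, identifying their coordinates as coordinates of the same vector in orthonormal bases related by $V$, the $r$-dimensional active subspaces coincide for every $r$, with eigenvector matrices chosen correspondingly ($Q_2=V^TQ_1$) in case of repeated eigenvalues. It is assumed the relevant gradient information matrices are finite. *)

(* Defs.v *)
From HB Require Import structures.
From mathcomp Require Import all_boot all_order all_algebra.
From mathcomp Require Import all_classical all_reals all_analysis.
Set Implicit Arguments. Unset Strict Implicit. Unset Printing Implicit Defensive.
Import Order.TTheory GRing.Theory Num.Theory.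
Import numFieldNormedType.Exports.
Local Open Scope classical_set_scope.
Local Open Scope ring_scope.

(* U is orthogonal: U^T U = I (for square matrices this is equivalent to U U^T = I). *)
Definition orthogonal_mx {R : realType} {d : nat} (U : 'M[R]_d) : Prop :=
  U^T *m U = 1%:M.

Definition lebesgue_null {R : realType} {d : nat} (N : set 'cV[R]_d) : Prop :=
  forall eps : R, 0 < eps ->
  exists a b : nat -> 'cV[R]_d,
    (forall k i, a k i 0 <= b k i 0) /\
    (N `<=` \bigcup_k [set z | forall i, a k i 0 <= z i 0 <= b k i 0]) /\
    (forall n, \sum_(k < n) \prod_(i < d) (b k i 0 - a k i 0) <= eps).

Definition differentiable_ae {R : realType} {d : nat} (g : 'cV[R]_d -> R) : Prop :=
  exists N : set 'cV[R]_d, lebesgue_null N /\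
    forall z, ~ N z -> differentiable g z.

(* Gradient: the column vector of partial derivatives (equal to the gradient
   wherever g is differentiable). *)
Definition grad {R : realType} {d : nat} (g : 'cV[R]_d -> R) (z : 'cV[R]_d) : 'cV[R]_d :=
  \col_i derive g z (delta_mx i 0).

Definition solves_opt_drift_eq {R : realType} {d : nat} (g : 'cV[R]_d -> R)
  (mu : 'cV[R]_d) : Prop :=
  differentiable g mu /\ g mu != 0 /\ (g mu)^-1 *: grad g mu = mu.

Definition IS_integrand {R : realType} {d : nat} (g : 'cV[R]_d -> R)
  (mu : 'cV[R]_d) (z : 'cV[R]_d) : R :=
  g (z + mu) * expR (- (mu^T *m z) 0 0 - (mu^T *m mu) 0 0 / 2).

Definition std_gaussian_vector {dT : measure_display} {T : measurableType dT}
  {R : realType} {d : nat} (P : probability T R) (Z : T -> 'cV[R]_d) : Prop :=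
  (forall i, measurable_fun setT (fun w => Z w i 0)) /\
  forall A : 'I_d -> set R, (forall i, measurable (A i)) ->
    P [set w | forall i, A i (Z w i 0)] = (\prod_(i < d) normal_prob 0 1 (A i))%E.

Definition gim_finite {dT : measure_display} {T : measurableType dT}
  {R : realType} {d : nat} (P : probability T R) (Z : T -> 'cV[R]_d)
  (h : 'cV[R]_d -> R) : Prop :=
  forall i j : 'I_d,
    P.-integrable setT (fun w => (grad h (Z w) i 0 * grad h (Z w) j 0)%:E).

Definition grad_info_mx {dT : measure_display} {T : measurableType dT}
  {R : realType} {d : nat} (P : probability T R) (Z : T -> 'cV[R]_d)
  (h : 'cV[R]_d -> R) : 'M[R]_d :=
  \matrix_(i, j) fine ('E_P[fun w => grad h (Z w) i 0 * grad h (Z w) j 0]).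

Definition eigendecomp {R : realType} {d : nat} (C Q : 'M[R]_d) (lam : 'rV[R]_d) : Prop :=
  orthogonal_mx Q /\ C = Q *m diag_mx lam *m Q^T /\
  forall i j : 'I_d, (i <= j)%N -> lam 0 j <= lam 0 i.

(* The r-dimensional active subspace associated with an eigenvector matrix Q:
   the span of the first r columns of Q. *)
Definition active_subspace {R : realType} {d : nat} (Q : 'M[R]_d) (r : nat) : set 'cV[R]_d :=
  [set x | exists c : 'cV[R]_d, (forall i : 'I_d, (r <= i)%N -> c i 0 = 0) /\ x = Q *m c].

Definition IA_integrand {R : realType} {d : nat} (gI : 'cV[R]_d -> R) (Q : 'M[R]_d)
  (z : 'cV[R]_d) : R := gI (Q *m z).

(* Main.v *)
(* With V = U: the drift equation is equivariant under U, so uniqueness gives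
   mu2 = U^T mu1 and hence g2I z = g1I (U z). By the chain rule the gradients
   satisfy (grad g2I) z = U^T (grad g1I) (U z) wherever g1I is differentiable at
   U z, and C2 = U^T C1 U follows from the rotation invariance of the Gaussian
   law. That invariance is obtained from plane rotations and sign changes, which
   generate the orthogonal group; plane rotations are products of shears, which
   preserve Lebesgue measure by Fubini and translation invariance. Since the
   gradient is arbitrary off the set of differentiability, it has to be replaced
   by a Borel function of z before invariance of the law can be applied. *)
Require Import Defs.
From HB Require Import structures.
From mathcomp Require Import all_boot all_order all_algebra.
From mathcomp Require Import all_classical all_reals all_analysis.
From mathcomp Require Import measurable_realfun ring lra.
Import Order.TTheory GRing.Theory Num.Theory.
Import numFieldNormedType.Exports.
Local Open Scope classical_set_scope.
Local Open Scope ring_scope.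

Set Implicit Arguments.
Unset Strict Implicit.
Unset Printing Implicit Defensive.

(** * Rotation invariance of the Gaussian measure of the plane *)

Section PlaneRotation.
Variable R : realType.
Local Notation lam := (@lebesgue_measure R).
Local Notation mR := (measurableTypeR R).

(** A measure is the Lebesgue measure as soon as it gives half-open intervals their length, and
    translation keeps that length. *)
Lemma lebesgue_measure_translation (t : R) (A : set R) : measurable A ->
  pushforward lam ((fun x => x + t) : _ -> mR) A = lam A.
Proof.
move=> mA; apply/esym/lebesgue_measure_unique => //=.
- exact: measurable_funD.
- move=> mf _ [[a b]] _ <-.
  rewrite /pushforward.
  rewrite [X in _ = lam X](_ : _ = `](a - t), (b - t)]%classic); last first.
    by apply/seteqP; split => x /=; rewrite !in_itv/= ltrBlDr lerBrDr.
  rewrite !lebesgue_measure_itv/= !lte_fin ltrD2r; case: ifP => // _.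
  by rewrite -!EFinB; congr EFin; ring.
Qed.

Lemma ge0_integral_translation (t : R) (f : mR -> \bar R) :
  measurable_fun setT f -> (forall x, 0 <= f x)%E ->
  (\int[lam]_x f ((x : R) + t)%R = \int[lam]_x f x)%E.
Proof.
move=> mf f0.
have mt : measurable_fun setT ((fun x => x + t) : mR -> mR).
  exact: measurable_funD.
transitivity (\int[pushforward lam (( +%R^~ t) : _ -> mR)]_x f x)%E.
  by rewrite ge0_integral_pushforward//= preimage_setT.
by apply: eq_measure_integral => A mA _; exact: lebesgue_measure_translation.
Qed.

(** With the second coordinate [y] frozen the shear is the translation by [t * y], so Tonelli
    reduces the claim to dimension one. *)
Lemma ge0_integral_shearl (t : R) (F : mR * mR -> \bar R) :
  measurable_fun setT F -> (forall z, 0 <= F z)%E ->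
  (\int[lam \x lam]_z F ((z.1 : R) + t * (z.2 : R), z.2)%R =
   \int[lam \x lam]_z F z)%E.
Proof.
move=> mF F0.
have mS : measurable_fun setT
    ((fun z => ((z.1 : R) + t * (z.2 : R), z.2)) : mR * mR -> mR * mR).
  apply: measurable_fun_pair => //; apply: measurable_funD => //.
  by apply: measurable_funM.
rewrite !fubini_tonelli2//; last exact: measurableT_comp mS.
apply: eq_integral => y _; rewrite /fubini_G/=.
apply: (@ge0_integral_translation _ (fun x => F (x, y))) => //.
by apply: measurableT_comp => //; exact: measurable_fun_pair.
Qed.

Lemma ge0_integral_shearr (t : R) (F : mR * mR -> \bar R) :
  measurable_fun setT F -> (forall z, 0 <= F z)%E ->
  (\int[lam \x lam]_z F (z.1, (z.2 : R) + t * (z.1 : R))%R =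
   \int[lam \x lam]_z F z)%E.
Proof.
move=> mF F0.
have mS : measurable_fun setT
    ((fun z => (z.1, (z.2 : R) + t * (z.1 : R))) : mR * mR -> mR * mR).
  apply: measurable_fun_pair => //; apply: measurable_funD => //.
  by apply: measurable_funM.
rewrite !fubini_tonelli1//; last exact: measurableT_comp mS.
apply: eq_integral => x _; rewrite /fubini_F/=.
apply: (@ge0_integral_translation _ (fun y => F (x, y))) => //.
by apply: measurableT_comp => //; exact: measurable_fun_pair.
Qed.

(* A rotation by an angle that is not a multiple of pi is a product of three
   shears: horizontal by t, vertical by - s, horizontal by t. *)
Lemma ge0_integral_rotation (c s : R) (F : mR * mR -> \bar R) :
  c ^+ 2 + s ^+ 2 = 1 -> s != 0 ->
  measurable_fun setT F -> (forall z, 0 <= F z)%E ->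
  (\int[lam \x lam]_z F (c * (z.1 : R) + s * (z.2 : R),
                         - s * (z.1 : R) + c * (z.2 : R))%R =
   \int[lam \x lam]_z F z)%E.
Proof.
(* For [c] and [s] the cosine and sine of an angle, [t] is the tangent of half the angle. *)
move=> cs s0 mF F0; pose t := (1 - c) / s.
have mS (u : R) : measurable_fun setT
    ((fun z => ((z.1 : R) + u * (z.2 : R), z.2)) : mR * mR -> mR * mR).
  apply: measurable_fun_pair => //; apply: measurable_funD => //.
  by apply: measurable_funM.
have mS' (u : R) : measurable_fun setT
    ((fun z => (z.1, (z.2 : R) + u * (z.1 : R))) : mR * mR -> mR * mR).
  apply: measurable_fun_pair => //; apply: measurable_funD => //.
  by apply: measurable_funM.
rewrite -(@ge0_integral_shearl t F)//.
rewrite -(@ge0_integral_shearr (- s) (fun z => F ((z.1 : R) + t * (z.2 : R), z.2)%R))//; last first.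
  exact: measurableT_comp (mS t).
rewrite -(@ge0_integral_shearl t (fun z => F ((z.1 : R) + t * ((z.2 : R) + (- s) * (z.1 : R)), (z.2 : R) + (- s) * (z.1 : R))))//; last first.
  apply: (measurableT_comp mF).
  exact: (measurableT_comp (mS t) (mS' (- s))).
apply: eq_integral => z _ /=.
(* These half-angle identities turn the entries [1 - s * t] and [t + t * (1 - s * t)] of the product
   of the shears into [c] and [s]. *)
have st : s * t = 1 - c by rewrite /t mulrC divfK.
have s2 : s * s = (1 - c) * (1 + c) by rewrite -expr2; lra.
have e1 : t * (1 + c) = s.
  by apply: (mulfI s0); rewrite mulrA st s2.
congr (F (_, _)).
- transitivity ((1 - s * t) * z.1 + (t + t * (1 - s * t)) * z.2); last by ring.
  rewrite st -e1; ring.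
- transitivity (- s * z.1 + (1 - s * t) * z.2); last by ring.
  rewrite st; ring.
Qed.

End PlaneRotation.

(** * The standard Gaussian measure of the plane *)

Section PlaneGaussian.
Variable R : realType.
Local Notation lam := (@lebesgue_measure R).
Local Notation mR := (measurableTypeR R).

Definition gauss_density2 (z : mR * mR) : R :=
  normal_pdf 0 1 (z.1 : R) * normal_pdf 0 1 (z.2 : R).

Lemma gauss_density2_ge0 z : 0 <= gauss_density2 z.
Proof. by rewrite mulr_ge0// normal_pdf_ge0. Qed.

Lemma measurable_gauss_density2 : measurable_fun setT gauss_density2.
Proof.
apply: measurable_funM.
- exact: (measurableT_comp (measurable_normal_pdf 0 1) measurable_fst).
- exact: (measurableT_comp (measurable_normal_pdf 0 1) measurable_snd).
Qed.

Lemma gauss_density2_rotation (c s x y : R) : c ^+ 2 + s ^+ 2 = 1 ->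
  gauss_density2 (c * x + s * y, - s * x + c * y) = gauss_density2 (x, y).
Proof.
move=> cs; rewrite /gauss_density2/= !normal_pdfE ?oner_neq0//.
rewrite !(mulrACA _ (normal_fun _ _ _)) /normal_fun -!expRD; congr (_ * expR _).
rewrite !subr0 -!mulrDl; congr (_ * _).
have -> : - (x ^+ 2) - y ^+ 2 = - (c ^+ 2 + s ^+ 2) * (x ^+ 2 + y ^+ 2) :> R.
  by rewrite cs; ring.
ring.
Qed.

(** Written as a density against planar Lebesgue measure, so that the change of variables by
    rotations applies to it directly. *)
Definition gauss2 (X : set (mR * mR)) : \bar R :=
  (\int[lam \x lam]_(z in X) (gauss_density2 z)%:E)%E.

Let gauss20 : gauss2 set0 = 0%E.
Proof. by rewrite /gauss2 integral_set0. Qed.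

Let gauss2_ge0 X : (0 <= gauss2 X)%E.
Proof. by apply: integral_ge0 => z _; rewrite lee_fin gauss_density2_ge0. Qed.

Let gauss2_sigma_additive : semi_sigma_additive gauss2.
Proof.
move=> A mA tA mUA; rewrite /gauss2/= ge0_integral_bigcup//=; last 2 first.
- apply: measurable_funTS; apply/measurable_EFinP.
  exact: measurable_gauss_density2.
- by move=> z _; rewrite lee_fin gauss_density2_ge0.
apply: is_cvg_ereal_nneg_natsum_cond => n _ _.
exact: gauss2_ge0.
Qed.

HB.instance Definition _ := isMeasure.Build _ _ _ gauss2
  gauss20 gauss2_ge0 gauss2_sigma_additive.

Lemma gauss2X (A B : set mR) : measurable A -> measurable B ->
  gauss2 (A `*` B) = (normal_prob 0 1 A * normal_prob 0 1 B)%E.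
Proof.
move=> mA mB; rewrite /gauss2 integral_mkcond fubini_tonelli1//; last 2 first.
- apply/(measurable_restrictT _ (measurableX mA mB)).
  apply: measurable_funTS; apply/measurable_EFinP.
  exact: measurable_gauss_density2.
- move=> z; rewrite patchE; case: ifP => // _.
  by rewrite lee_fin gauss_density2_ge0.
rewrite {1}/normal_prob [X in (X * _)%E]integral_mkcond.
rewrite -ge0_integralZr//; last 2 first.
- apply/(measurable_restrictT _ mA).
  apply: measurable_funTS; apply/measurable_EFinP.
  exact: measurable_normal_pdf.
- by move=> z; rewrite patchE; case: ifP => // _; rewrite lee_fin normal_pdf_ge0.
apply: eq_integral => x _; rewrite /fubini_F/= !patchE.
have [xA|xA] := ifPn; last first.
  rewrite mul0e; apply: integral0_eq => y _; rewrite patchE ifF//.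
  by apply/negbTE; apply: contra xA; rewrite !inE => -[].
rewrite /normal_prob [in RHS]integral_mkcond -ge0_integralZl//; last 3 first.
- apply/(measurable_restrictT _ mB).
  apply: measurable_funTS; apply/measurable_EFinP.
  exact: measurable_normal_pdf.
- by move=> z; rewrite patchE; case: ifP => // _; rewrite lee_fin normal_pdf_ge0.
- by rewrite lee_fin normal_pdf_ge0.
apply: eq_integral => y _; rewrite !patchE in_setX xA/=.
by case: ifP => // _; rewrite mule0.
Qed.

Lemma measurable_rotation (c s : R) : measurable_fun setT
  ((fun z => (c * (z.1 : R) + s * (z.2 : R), - s * (z.1 : R) + c * (z.2 : R)))
    : mR * mR -> mR * mR).
Proof.
by apply: measurable_fun_pair; apply: measurable_funD => //; apply: measurable_funM.
Qed.

Lemma gauss2_rotation (c s : R) (X : set (mR * mR)) :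
  c ^+ 2 + s ^+ 2 = 1 -> s != 0 -> measurable X ->
  gauss2 [set z | X (c * (z.1 : R) + s * (z.2 : R),
                     - s * (z.1 : R) + c * (z.2 : R))] = gauss2 X.
Proof.
move=> cs s0 mX; rewrite /gauss2 [RHS]integral_mkcond.
rewrite -(ge0_integral_rotation cs s0)//; last 2 first.
- apply/(measurable_restrictT _ mX).
  apply: measurable_funTS; apply/measurable_EFinP.
  exact: measurable_gauss_density2.
- move=> z; rewrite patchE; case: ifP => // _.
  by rewrite lee_fin gauss_density2_ge0.
rewrite [LHS]integral_mkcond; apply: eq_integral => -[x y] _.
by rewrite !patchE/= gauss_density2_rotation.
Qed.

(** Rectangles are stable under intersection and generate the product sigma-algebra, so [nu] is [k]
    times [gauss2]. The factor [k] admits laws of two coordinates restricted to an event on the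
    others, whose mass may be below 1. *)
Lemma rotation_invariance (nu : {measure set (mR * mR) -> \bar R})
    (k : {nonneg R}) (c s : R) :
  (forall A B, measurable A -> measurable B ->
    nu (A `*` B) = (k%:num%:E * (normal_prob 0 1 A * normal_prob 0 1 B))%E) ->
  c ^+ 2 + s ^+ 2 = 1 -> s != 0 ->
  forall X, measurable X ->
  nu [set z | X (c * (z.1 : R) + s * (z.2 : R),
                 - s * (z.1 : R) + c * (z.2 : R))] = nu X.
Proof.
move=> nuX cs s0.
have nuE X : measurable X -> nu X = mscale k gauss2 X.
  apply: (measure_unique
    [set C | exists A, measurable A /\ exists B, measurable B /\ C = A `*` B]
    (fun=> setT)).
  - rewrite measurable_prod_measurableType; congr (<<s _ >>).
    apply/seteqP; split => [_ [A mA [B mB <-]]|_ [A [mA [B [mB ->]]]]].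
      by exists A; split => //; exists B.
    by exists A => //; exists B.
  - move=> _ _ [X1 [mX1 [X2 [mX2 ->]]]] [Y1 [mY1 [Y2 [mY2 ->]]]].
    rewrite -setXI; exists (X1 `&` Y1); split; first exact: measurableI.
    by exists (X2 `&` Y2); split => //; exact: measurableI.
  - by move=> _; exists setT; split => //; exists setT; split => //; rewrite setXTT.
  - by rewrite bigcup_const.
  - by move=> _ [A [mA [B [mB ->]]]]; rewrite nuX// -gauss2X.
  - by move=> _; rewrite -setXTT nuX// !probability_setT !mule1 ltry.
move=> X mX; rewrite !nuE//; last first.
  by rewrite -[X in measurable X]setTI; exact: measurable_rotation.
by congr (_ * _)%E; exact: gauss2_rotation.
Qed.

End PlaneGaussian.

(** * Generation of the orthogonal group *)

Section Givens.
Variables (R : realType) (d : nat).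

Definition givens (p q : 'I_d) (c s : R) : 'M[R]_d :=
  1%:M + (c - 1) *: delta_mx p p + s *: delta_mx p q
  - s *: delta_mx q p + (c - 1) *: delta_mx q q.

Definition flip (p : 'I_d) : 'M[R]_d := 1%:M - 2 *: delta_mx p p.

Let addmxE m n (A B : 'M[R]_(m, n)) i j : (A + B) i j = A i j + B i j.
Proof. by rewrite mxE. Qed.

Let oppmxE m n (A : 'M[R]_(m, n)) i j : (- A) i j = - A i j.
Proof. by rewrite mxE. Qed.

Let scalemxE m n a (A : 'M[R]_(m, n)) i j : (a *: A) i j = a * A i j.
Proof. by rewrite mxE. Qed.

Lemma mul_delta_mxE m (i j : 'I_d) (A : 'M[R]_(d, m)) k l :
  (delta_mx i j *m A) k l = (k == i)%:R * A j l.
Proof.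
rewrite mxE (bigD1 j)//= big1 ?addr0 => [|x xj].
  by rewrite mxE eqxx andbT.
by rewrite mxE (negbTE xj) andbF mul0r.
Qed.

Lemma givens_mulE m p q c s (A : 'M[R]_(d, m)) i j : p != q ->
  (givens p q c s *m A) i j =
  if i == p then c * A p j + s * A q j
  else if i == q then - s * A p j + c * A q j else A i j.
Proof.
move=> pq; rewrite /givens !mulmxDl mulNmx -!scalemxAl mul1mx.
rewrite !(addmxE, oppmxE, scalemxE) !mul_delta_mxE.
have [->|ip] := eqVneq i p.
  by rewrite (negbTE pq) !mul1r !mul0r !mulr0 subr0 addr0; ring.
have [->|iq] := eqVneq i q; first by rewrite !mul1r !mul0r !mulr0; ring.
by rewrite !mul0r !mulr0 subr0 !addr0.
Qed.

Lemma flip_mulE m p (A : 'M[R]_(d, m)) i j :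
  (flip p *m A) i j = if i == p then - A p j else A i j.
Proof.
rewrite /flip mulmxDl mulNmx -!scalemxAl mul1mx.
rewrite !(addmxE, oppmxE, scalemxE) !mul_delta_mxE.
by have [->|ip] := eqVneq i p; rewrite ?mul1r ?mul0r; ring.
Qed.

Lemma givensK m p q c s (A : 'M[R]_(d, m)) : p != q -> c ^+ 2 + s ^+ 2 = 1 ->
  givens p q c (- s) *m (givens p q c s *m A) = A.
Proof.
move=> pq cs; apply/matrixP => i j; rewrite !givens_mulE// !eqxx.
rewrite (eq_sym q p) (negbTE pq).
have [->|ip] := eqVneq i p; first by rewrite -[RHS]mul1r -cs; ring.
by have [->|iq//] := eqVneq i q; rewrite -[RHS]mul1r -cs; ring.
Qed.

Lemma flipK m p (A : 'M[R]_(d, m)) : flip p *m (flip p *m A) = A.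
Proof.
apply/matrixP => i j; rewrite !flip_mulE eqxx.
by have [->|//] := eqVneq i p; rewrite opprK.
Qed.

Lemma givens_tr p q c s : (givens p q c s)^T = givens p q c (- s).
Proof.
apply/matrixP => i j; rewrite !mxE (eq_sym j i) !(andbC (j == _)).
by ring.
Qed.

Lemma flip_tr p : (flip p)^T = flip p.
Proof. by rewrite /flip raddfB/= linearZ/= trmx1 trmx_delta. Qed.

Lemma orthogonal_givens p q c s : p != q -> c ^+ 2 + s ^+ 2 = 1 ->
  orthogonal_mx (givens p q c s).
Proof.
move=> pq cs; rewrite /orthogonal_mx givens_tr.
by rewrite -[X in _ *m X]mulmx1 givensK.
Qed.

Lemma orthogonal_flip p : orthogonal_mx (flip p).
Proof.
by rewrite /orthogonal_mx flip_tr -[X in _ *m X]mulmx1 flipK.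
Qed.

Lemma orthogonal_mulmx (U V : 'M[R]_d) : orthogonal_mx U -> orthogonal_mx V ->
  orthogonal_mx (U *m V).
Proof.
by rewrite /orthogonal_mx => oU oV; rewrite trmx_mul -mulmxA (mulmxA U^T) oU mul1mx.
Qed.

End Givens.

(** * Reduction of an orthogonal matrix to the identity by plane rotations and sign changes *)

Section OrthogonalInduction.
Variables (R : realType) (d : nat) (good : 'M[R]_d -> Prop).
Hypothesis good1 : good 1%:M.
Hypothesis goodM : forall U V, good U -> good V -> good (U *m V).
Hypothesis good_givens : forall p q c s, p != q -> c ^+ 2 + s ^+ 2 = 1 ->
  s != 0 -> good (givens p q c s).
Hypothesis good_flip : forall p, good (flip R p).

Let reduced k (U : 'M[R]_d) := forall i j : 'I_d, (j < k)%N -> U i j = (i == j)%:R.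

(** Induction on the number [k] of columns that may still differ from those of the identity. Each
    factor applied on the left has an inverse of the same kind, so [goodM] carries [good] back to
    the matrix before the reduction. *)
Lemma orthogonal_ind (U : 'M[R]_d) : orthogonal_mx U -> good U.
Proof.
have main k : (k <= d)%N -> forall U : 'M[R]_d, orthogonal_mx U ->
    reduced (d - k) U -> good U.
  elim: k => [_|k IH kd] {}U oU rU.
    suff -> : U = 1%:M by [].
    apply/matrixP => i j; rewrite rU ?mxE// subn0; exact: ltn_ord.
  have lt_dk : (d - k.+1 < d)%N by rewrite ltn_subrL (leq_ltn_trans _ kd).
  (* The first column not yet reduced. *)
  pose p := Ordinal lt_dk.
  have colE (V : 'M[R]_d) (j l : 'I_d) : orthogonal_mx V ->
      \sum_i V i j * V i l = (j == l)%:R.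
    move=> /matrixP/(_ j l); rewrite !mxE => <-.
    by apply: eq_bigr => i _; rewrite mxE.
  (* Column [j] is already a unit vector, so its inner product with column [p] is the entry [V j p],
     which orthogonality makes zero. *)
  have row0 (V : 'M[R]_d) (j : 'I_d) : orthogonal_mx V ->
      reduced (d - k.+1) V -> (j < d - k.+1)%N -> V j p = 0.
    move=> oV rV jk; have := colE V j p oV.
    rewrite (bigD1 j)//= big1 ?addr0 => [|i ij]; last first.
      by rewrite rV// (negbTE ij) mul0r.
    rewrite rV// eqxx mul1r => ->.
    by have /negbTE -> : j != p by rewrite -val_eqE/= neq_ltn jk.
  (* Givens rotations clear the entries of column p below the diagonal one at a
     time; at the end the p-th column is a signed unit vector by orthogonality. *)
  suff step n : (n <= d)%N -> forall V : 'M[R]_d, orthogonal_mx V ->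
      reduced (d - k.+1) V ->
      (forall i : 'I_d, (p < i)%N -> (i < d - n)%N -> V i p = 0) -> good V.
    apply: (step d (leqnn d) U oU rU) => i _; by rewrite subnn.
  elim: n => [_|n IHn nd] V oV rV zV.
    have V0 (i : 'I_d) : i != p -> V i p = 0.
      rewrite -val_eqE/= neq_ltn => /orP[ip|ip]; first exact: row0.
      by apply: zV => //; rewrite subn0.
    have : V p p ^+ 2 = 1.
      have := colE V p p oV; rewrite (bigD1 p)//= big1 ?addr0 ?eqxx//.
      by move=> i ip; rewrite V0// mul0r.
    move=> /eqP; rewrite sqrf_eq1.
    have redk (W : 'M[R]_d) : reduced (d - k.+1) W ->
       (forall i, i != p -> W i p = 0) -> W p p = 1 -> reduced (d - k) W.
      move=> rW W0 Wp i j; rewrite -subnSK// ltnS leq_eqVlt => /orP[jp|]; last exact: rW.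
      have -> : j = p by apply/val_inj/eqP.
      by have [->|ip] := eqVneq i p; [rewrite Wp|rewrite W0].
    have kd' : (k <= d)%N by exact: ltnW.
    move=> /orP[/eqP Vp|/eqP Vp]; first exact: (IH kd' V oV (redk _ rV V0 Vp)).
    (* A pivot equal to -1 is corrected by a sign change, which is its own inverse. *)
    rewrite -(flipK p V); apply: goodM => //; apply: (IH kd').
      by apply: orthogonal_mulmx => //; exact: orthogonal_flip.
    apply: redk.
    - move=> i j jk; rewrite flip_mulE; case: eqP => [->|_]; last exact: rV.
      rewrite rV//; have /negbTE -> : p != j by rewrite -val_eqE/= gtn_eqF.
      by rewrite oppr0.
    - by move=> i ip; rewrite flip_mulE (negbTE ip) V0.
    - by rewrite flip_mulE eqxx Vp opprK.
  have lt_dn : (d - n.+1 < d)%N by rewrite ltn_subrL (leq_ltn_trans _ nd).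
  pose q := Ordinal lt_dn.
  have next (W : 'M[R]_d) : W q p = 0 ->
      (forall i : 'I_d, (p < i)%N -> (i < d - n.+1)%N -> W i p = 0) ->
      forall i : 'I_d, (p < i)%N -> (i < d - n)%N -> W i p = 0.
    move=> Wq W0 i pi; rewrite -subnSK// ltnS leq_eqVlt => /orP[iq|]; last exact: W0.
    by have -> : i = q by apply/val_inj/eqP.
  have nd' := ltnW nd.
  have [Vq|Vq] := eqVneq (V q p) 0; first exact: (IHn nd' V oV rV (next V Vq zV)).
  (* Rows are scanned from index 0; as long as [q] is not below the diagonal the range to be cleared
     is empty. *)
  have [pq|pq] := ltnP p q; last first.
    apply: (IHn nd' V oV rV) => i pi iq; apply: zV => //.
    move: iq; rewrite -subnSK// ltnS leq_eqVlt => /orP[/eqP iq|//].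
    by move: (leq_ltn_trans pq pi); rewrite iq /= ltnn.
  have pq' : p != q by rewrite -val_eqE/= ltn_eqF.
  pose r := Num.sqrt (V p p ^+ 2 + V q p ^+ 2).
  have r2 : r ^+ 2 = V p p ^+ 2 + V q p ^+ 2.
    by rewrite sqr_sqrtr// addr_ge0// sqr_ge0.
  have r0 : r != 0.
    rewrite sqrtr_eq0 -ltNge ltr_pwDr ?sqr_ge0//.
    by rewrite exprn_even_gt0//= Vq.
  (* Chosen so that the new entry [- s * V p p + c * V q p] vanishes; [V q p != 0] provides the
     [s != 0] that [good_givens] asks for. *)
  pose c := V p p / r; pose s := V q p / r.
  have cs : c ^+ 2 + s ^+ 2 = 1.
    by rewrite /c /s !exprMn -mulrDl -r2 exprVn divff// expf_neq0.
  have s0 : s != 0 by rewrite mulf_neq0// invr_eq0.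
  rewrite -(givensK V pq' cs); apply: goodM.
    by apply: good_givens; rewrite ?oppr_eq0// sqrrN.
  apply: (IHn nd').
  - by apply: orthogonal_mulmx => //; exact: orthogonal_givens.
  (* The reduced columns have zeros in rows [p] and [q], so the rotation leaves them unchanged. *)
  - move=> i j jk; rewrite givens_mulE//.
    have jp : (p == j) = false by rewrite -val_eqE/= gtn_eqF.
    have jq : (q == j) = false.
      by rewrite -val_eqE/= gtn_eqF// (leq_trans jk)//; exact: ltnW.
    have [->|ip] := eqVneq i p; first by rewrite !rV// jp jq !mulr0 addr0.
    have [->|iq] := eqVneq i q; first by rewrite !rV// jp jq !mulr0 addr0.
    exact: rV.
  - apply: next.
      rewrite givens_mulE// eq_sym (negbTE pq') eqxx /c /s.
      by ring.
    move=> i pi iq; rewrite givens_mulE//.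
    have /negbTE -> : i != p by rewrite -val_eqE/= gtn_eqF.
    have /negbTE -> : i != q by rewrite -val_eqE/= ltn_eqF.
    exact: zV.
move=> oU; apply: (main d (leqnn d) U oU) => i j; by rewrite subnn.
Qed.

End OrthogonalInduction.

(** * Orthogonal invariance of standard Gaussian vectors *)

Section GaussianVector.
Context {dT : measure_display} {T : measurableType dT} {R : realType} {d : nat}.
Variable P : probability T R.
Implicit Type Z : T -> 'cV[R]_d.

Lemma normal_probN (A : set R) : measurable A ->
  normal_prob 0 1 [set x | A (- x)] = normal_prob 0 1 A.
Proof.
move=> mA; rewrite /normal_prob [RHS]integral_mkcond.
have mN : measurable_fun setT (-%R : measurableTypeR R -> measurableTypeR R).
  exact: measurable_funN.
transitivity (\int[pushforward lebesgue_measure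
    (-%R : measurableTypeR R -> measurableTypeR R)]_x
    ((EFin \o normal_pdf 0 1) \_ A) x)%E; last first.
  by apply: eq_measure_integral => B mB _; exact: lebesgue_measureN.
rewrite ge0_integral_pushforward//=; last 2 first.
- apply/(measurable_restrictT _ mA).
  by apply: measurable_funTS; apply/measurable_EFinP; exact: measurable_normal_pdf.
- by move=> x _; rewrite patchE; case: ifP => // _; rewrite lee_fin normal_pdf_ge0.
rewrite preimage_setT [LHS]integral_mkcond; apply: eq_integral => x _.
rewrite /= !patchE; congr (if _ then _ else _).
by rewrite /= !normal_pdfE ?oner_neq0// /normal_fun !subr0 sqrrN.
Qed.

(** The density is at most its peak, the inverse square root of 2 pi, hence at most 1. This crude
    bound is enough to compare Gaussian mass with volume in a covering by boxes. *)
Lemma normal_prob_itv_le (a b : R) : a <= b ->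
  (normal_prob 0 1 `[a, b]%classic <= (b - a)%:E)%E.
Proof.
move=> ab; rewrite /normal_prob.
apply: (@le_trans _ _ (\int[lebesgue_measure]_(x in `[a, b]) (cst 1%E x))%E).
  apply: ge0_le_integral => //.
  - by move=> x _; rewrite lee_fin normal_pdf_ge0.
  - by apply: measurable_funTS; apply/measurable_EFinP; exact: measurable_normal_pdf.
  - move=> x _; rewrite lee_fin (le_trans (normal_pdf_ub _ _ _)) ?oner_neq0//.
    have pi2 : 1 <= pi *+ 2 :> R by rewrite mulr2n; have := @pi_ge2 R; lra.
    rewrite /normal_peak expr1n mul1r invf_le1 ?sqrtr_gt0 ?(lt_le_trans ltr01)//.
    by rewrite -[leLHS]sqrtr1 ler_wsqrtr.
rewrite integral_cst//= mul1e lebesgue_measure_itv/= lte_fin.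
by case: ltP => // _; rewrite lee_fin subr_ge0.
Qed.

Definition measurable_vector Z := forall i, measurable_fun setT (fun w => Z w i 0).

Lemma measurable_box Z (A : 'I_d -> set R) : measurable_vector Z ->
  (forall i, measurable (A i)) -> measurable [set w | forall i, A i (Z w i 0)].
Proof.
move=> mZ mA.
rewrite (_ : [set w | _] = \bigcap_(i in [set: 'I_d]) ((fun w => Z w i 0) @^-1` A i)).
  apply: fin_bigcap_measurable => // i _.
  by rewrite -[X in measurable X]setTI; exact: mZ.
by apply/seteqP; split => [w Aw i _|w Aw i]; exact: Aw.
Qed.

Lemma measurable_vector_mulmx Z (U : 'M[R]_d) : measurable_vector Z ->
  measurable_vector (fun w => U *m Z w).
Proof.
move=> mZ i.
rewrite (_ : (fun w => _) = (fun w => \sum_j U i j * Z w j 0)); last first.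
  by apply/funext => w; rewrite mxE.
by apply: measurable_sum => j; apply: measurable_funM.
Qed.

Lemma std_gaussian_flip Z p : std_gaussian_vector P Z ->
  std_gaussian_vector P (fun w => flip R p *m Z w).
Proof.
move=> [mZ gZ]; split=> [|A mA]; first exact: measurable_vector_mulmx.
pose A' i := if i == p then [set x | A p (- x)] else A i.
have mA' i : measurable (A' i).
  rewrite /A'; case: ifP => // _.
  by rewrite -[X in measurable X]setTI; exact: measurable_funN.
rewrite (_ : [set w | _] = [set w | forall i, A' i (Z w i 0)]).
  rewrite gZ//; apply: eq_bigr => i _; rewrite /A'.
  by case: eqP => // ->; rewrite normal_probN.
apply/seteqP; split=> w Aw i; move: (Aw i); rewrite /A' flip_mulE.
  by case: eqP => // ->.
by case: eqP => // ->.
Qed.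

(** Only coordinates [p] and [q] move. On the event that the others lie in their prescribed sets,
    the pair has a law that is a constant multiple of the planar Gaussian on rectangles, and planar
    invariance applies. *)
Lemma std_gaussian_givens Z p q c s : p != q -> c ^+ 2 + s ^+ 2 = 1 -> s != 0 ->
  std_gaussian_vector P Z ->
  std_gaussian_vector P (fun w => givens p q c s *m Z w).
Proof.
move=> pq cs s0 [mZ gZ]; split=> [|A mA]; first exact: measurable_vector_mulmx.
have qp : (q == p) = false by rewrite eq_sym (negbTE pq).
(* The family [A] with its members at [p] and [q] replaced by [B] and [C]; [E] below leaves these
   two coordinates free. *)
pose A' (B C : set R) i := if i == p then B else if i == q then C else A i.
have mA' B C : measurable B -> measurable C -> forall i, measurable (A' B C i).
  by move=> mB mC i; rewrite /A'; case: ifP => // _; case: ifP.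
pose E := [set w | forall i, A' setT setT i (Z w i 0)].
have mE : measurable E by apply: measurable_box => //; exact: mA'.
pose XY w : measurableTypeR R * measurableTypeR R := (Z w p 0, Z w q 0).
have mXY : measurable_fun setT XY by apply: measurable_fun_pair; exact: mZ.
have [nu nuE] : exists nu : {measure set (measurableTypeR R * measurableTypeR R)
    -> \bar R}, forall X, nu X = P (XY @^-1` X `&` E).
  by unshelve eexists (pushforward (mrestr P mE) XY).
(* The probability of [E], which is the total mass of [nu]. *)
pose K := (\prod_(i < d | (i != p) && (i != q)) normal_prob 0 1 (A i))%E.
have prodE B C : (\prod_(i < d) normal_prob 0 1 (A' B C i) =
    K * (normal_prob 0 1 B * normal_prob 0 1 C))%E.
  rewrite (bigD1 p)//= (bigD1 q) /A' ?eqxx ?qp//= muleA muleC.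
  congr (_ * _)%E; apply: eq_bigr => i /andP[/negbTE -> /negbTE ->] //.
have K0 : (0 <= K)%E by apply: prode_ge0.
have Kfin : K \is a fin_num by apply: prode_fin_num => i _; apply: (@fin_num_measure _ _ _ (normal_prob 0 1)); exact: mA.
have nuXA B C : measurable B -> measurable C ->
    nu (B `*` C) = (\prod_(i < d) normal_prob 0 1 (A' B C i))%E.
  move=> mB mC; rewrite nuE -gZ; last exact: mA'.
  congr (P _); apply/seteqP; split => w.
    move=> [[/= Bw Cw] Ew] i; move: (Ew i); rewrite /A'.
    by case: eqP => [->//|_]; case: eqP => [->|].
  move=> Aw; split; first split => /=.
  - by move: (Aw p); rewrite /A' eqxx.
  - by move: (Aw q); rewrite /A' eqxx qp.
  - by move=> i; move: (Aw i); rewrite /A'; case: ifP => // _; case: ifP.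
have nuX B C : measurable B -> measurable C -> nu (B `*` C) =
    ((NngNum (fine_ge0 K0))%:num%:E * (normal_prob 0 1 B * normal_prob 0 1 C))%E.
  by move=> mB mC; rewrite nuXA// prodE /= fineK.
transitivity (nu [set z | (A p `*` A q) (c * (z.1 : R) + s * (z.2 : R),
                             - s * (z.1 : R) + c * (z.2 : R))]).
  rewrite nuE; congr (P _); apply/seteqP; split => w.
    move=> Aw; split; first split => /=.
    - by move: (Aw p); rewrite givens_mulE// eqxx.
    - by move: (Aw q); rewrite givens_mulE// eqxx qp.
    - move=> i; move: (Aw i); rewrite givens_mulE// /A'.
      by case: ifP => // _; case: ifP.
  move=> [[/= Bw Cw] Ew] i; move: (Ew i); rewrite givens_mulE// /A'.
  by case: eqP => [->//|_]; case: eqP => [->|].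
rewrite (rotation_invariance nuX cs s0)//; last exact: measurableX.
rewrite nuXA; [|exact: mA|exact: mA]; apply: eq_bigr => i _; rewrite /A'.
by case: eqP => [->//|_]; case: eqP => [->|].
Qed.

(** The property fed to [orthogonal_ind] quantifies over all [Z]: for a product of matrices it is
    applied to [Z] and then to the transformed vector. *)
Lemma std_gaussian_orthogonal Z (U : 'M[R]_d) : orthogonal_mx U ->
  std_gaussian_vector P Z -> std_gaussian_vector P (fun w => U *m Z w).
Proof.
move=> oU; move: Z.
apply: (@orthogonal_ind R d (fun U => forall Z, std_gaussian_vector P Z ->
    std_gaussian_vector P (fun w => U *m Z w)) _ _ _ _ U oU).
- move=> Z gZ; rewrite (_ : (fun w => _) = Z)//.
  by apply/funext => w; rewrite mul1mx.
- move=> V W gV gW Z /gW/gV.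
  rewrite (_ : (fun w => V *m (W *m Z w)) = (fun w => V *m W *m Z w))//.
  by apply/funext => w; rewrite mulmxA.
- by move=> p q c s pq cs s0 Z; exact: std_gaussian_givens.
- by move=> p Z; exact: std_gaussian_flip.
Qed.

End GaussianVector.

Lemma lee_prod_ge0 (R : realType) (I : finType) (f g : I -> \bar R) :
  (forall i, 0 <= f i)%E -> (forall i, f i <= g i)%E ->
  (\prod_i f i <= \prod_i g i)%E.
Proof.
move=> f0 fg.
suff [] : (0 <= \prod_i f i /\ \prod_i f i <= \prod_i g i)%E by [].
elim/big_ind2 : _ => [|x1 x2 y1 y2 [x10 x12] [y10 y12]|i _]; split => //.
- exact: mule_ge0.
- exact: lee_pmul.
Qed.

(** * Absolute continuity of the Gaussian law *)

Section GaussianNull.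
Context {dT : measure_display} {T : measurableType dT} {R : realType} {d : nat}.
Variables (P : probability T R) (Z : T -> 'cV[R]_d).
Hypothesis gZ : std_gaussian_vector P Z.

(** Covering boxes translated by [- mu] keep their volume, and the Gaussian mass of a box is at most
    its volume. The shift is there because the IS integrand evaluates [g] at [z + mu]. *)
Lemma negligible_lebesgue_null (N : set 'cV[R]_d) (mu : 'cV[R]_d) :
  lebesgue_null N -> P.-negligible [set w | N (Z w + mu)].
Proof.
move=> nullN; have [mZ PZ] := gZ.
have cover eps : 0 < eps -> exists B, [/\ measurable B,
    [set w | N (Z w + mu)] `<=` B & (P B <= eps%:E)%E].
  move=> /nullN[a [b [ab [Nab sab]]]].
  pose A k i : set R := `[a k i 0 - mu i 0, b k i 0 - mu i 0]%classic.
  pose F k := [set w | forall i, A k i (Z w i 0)].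
  have mF k : measurable (F k) by apply: (@measurable_box _ _ _ _ Z (A k)) => // i; exact: measurable_itv.
  exists (\bigcup_k F k); split.
  - exact: bigcup_measurable.
  - move=> w /Nab[k _ /= h]; exists k => // i; have := h i.
    by rewrite /A/= in_itv/= mxE lerBlDr lerBrDr.
  - apply: (le_trans (generalized_Boole_inequality P mF _)).
      exact: bigcup_measurable.
    apply: lime_le; first exact: is_cvg_nneseries.
    apply: nearW => n; rewrite /= big_mkord.
    apply: (@le_trans _ _ (\sum_(k < n) \prod_(i < d) (b k i 0 - a k i 0))%:E); last first.
      by rewrite lee_fin.
    rewrite -sumEFin; apply: lee_sum => k _; rewrite PZ => [|i]; last exact: measurable_itv.
    rewrite -prodEFin.
    apply: lee_prod_ge0 => i; first exact: measure_ge0.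
    apply: (le_trans (normal_prob_itv_le _)).
      by rewrite lerD2r.
    by rewrite lee_fin opprB addrA subrK.
(* The event itself need not be measurable; the intersection of covers of mass at most [1 / (n + 1)]
   is a measurable null set containing it. *)
have /choice[B BP] : forall n, exists B, [/\ measurable B,
    [set w | N (Z w + mu)] `<=` B & (P B <= (n.+1%:R^-1)%:E)%E].
  by move=> n; apply: cover; rewrite invr_gt0.
exists (\bigcap_n B n); split.
- by apply: bigcap_measurable => // n _; have [] := BP n.
- apply/eqP; rewrite eq_le measure_ge0 andbT.
  apply/lee_addgt0Pr => e e0; rewrite add0e.
  have [n ne] : exists n, n.+1%:R^-1 <= e.
    exists (Num.truncn e^-1); rewrite invf_ple ?posrE//.
    by rewrite ltW// truncnS_gt.
  have [mB _ PB] := BP n; apply: (@le_trans _ _ (P (B n))).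
    apply: le_measure; rewrite ?inE//; last exact: bigcap_inf.
    by apply: bigcap_measurable => // k _; have [] := BP k.
  by apply: (le_trans PB); rewrite lee_fin.
- by move=> w Nw n _; have [_ + _] := BP n; apply.
Qed.

End GaussianNull.

(** * Uniqueness of the standard Gaussian law *)

Section VectorSigmaAlgebra.
Context {R : realType} {d : nat}.

(** These are the sets on which [std_gaussian_vector] prescribes the law. They are stable under
    intersection, and the sigma-algebra they generate is the Borel one. *)
Definition boxes : set (set 'cV[R]_d) :=
  [set C | exists A : 'I_d -> set R, (forall i, measurable (A i)) /\
     C = [set z : 'cV[R]_d | forall i, A i (z i 0)]].

Definition borel_vector := g_sigma_algebraType boxes.

Lemma boxes_setI_closed : setI_closed boxes.
Proof.
move=> _ _ [A [mA ->]] [B [mB ->]].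
exists (fun i => A i `&` B i); split; first by move=> i; exact: measurableI.
by apply/seteqP; split=> z; [move=> [Az Bz] i; split|move=> ABz; split=> i; case: (ABz i)].
Qed.

Context {dT : measure_display} {T : measurableType dT}.
Variable P : probability T R.

Lemma measurable_vectorP (Z : T -> 'cV[R]_d) : measurable_vector Z ->
  measurable_fun setT (Z : T -> borel_vector).
Proof.
move=> mZ; apply: (@measurability _ _ T borel_vector setT Z boxes) => // _ [_ [A [mA ->]] <-].
by rewrite setTI; exact: measurable_box.
Qed.

Variables Z W : T -> 'cV[R]_d.
Hypotheses (gZ : std_gaussian_vector P Z) (gW : std_gaussian_vector P W).

Lemma gaussian_law_unique (X : set borel_vector) : measurable X ->
  P (Z @^-1` X) = P (W @^-1` X).
Proof.
have mZ := measurable_vectorP gZ.1; have mW := measurable_vectorP gW.1.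
have [PZ PZE] : exists nu : {measure set borel_vector -> \bar R},
    forall X, nu X = P (Z @^-1` X).
  by unshelve eexists (pushforward P (Z : T -> borel_vector)).
have [PW PWE] : exists nu : {measure set borel_vector -> \bar R},
    forall X, nu X = P (W @^-1` X).
  by unshelve eexists (pushforward P (W : T -> borel_vector)).
move=> mX; rewrite -PZE -PWE; move: X mX.
apply: (@measure_unique _ R borel_vector boxes (fun=> setT) _ _ _ _ PZ PW) => //.
- exact: boxes_setI_closed.
- move=> _; exists (fun=> setT); split => //.
  by apply/seteqP; split.
- by rewrite bigcup_const.
- by move=> _ [A [mA ->]]; rewrite PZE PWE [LHS]gZ.2// [RHS]gW.2.
- by move=> _; rewrite PZE preimage_setT probability_setT ltry.
Qed.

Lemma ge0_integral_gaussian (f : borel_vector -> \bar R) :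
  measurable_fun setT f -> (forall z, 0 <= f z)%E ->
  (\int[P]_w f (Z w) = \int[P]_w f (W w))%E.
Proof.
move=> mf f0.
have mZ := measurable_vectorP gZ.1; have mW := measurable_vectorP gW.1.
transitivity (\int[pushforward P (Z : T -> borel_vector)]_x f x)%E.
  by rewrite ge0_integral_pushforward//= preimage_setT.
transitivity (\int[pushforward P (W : T -> borel_vector)]_x f x)%E; last first.
  by rewrite ge0_integral_pushforward//= preimage_setT.
by apply: eq_measure_integral => A mA _; exact: gaussian_law_unique.
Qed.

Lemma integral_gaussian (f : borel_vector -> \bar R) : measurable_fun setT f ->
  (\int[P]_w f (Z w) = \int[P]_w f (W w))%E.
Proof.
move=> mf; rewrite integralE [RHS]integralE; congr (_ - _)%E.
- transitivity (\int[P]_w f^\+ (Z w))%E.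
    by congr (integral P setT _); exact: (funepos_comp f Z).
  rewrite (ge0_integral_gaussian (measurable_funepos mf) (funepos_ge0 f)).
  by congr (integral P setT _); apply: esym; exact: (funepos_comp f W).
- transitivity (\int[P]_w f^\- (Z w))%E.
    by congr (integral P setT _); exact: (funeneg_comp f Z).
  rewrite (ge0_integral_gaussian (measurable_funeneg mf) (funeneg_ge0 f)).
  by congr (integral P setT _); apply: esym; exact: (funeneg_comp f W).
Qed.

Lemma integrable_gaussian (f : borel_vector -> \bar R) : measurable_fun setT f ->
  P.-integrable setT (fun w => f (Z w)) -> P.-integrable setT (fun w => f (W w)).
Proof.
move=> mf /integrableP[_ foo]; apply/integrableP; split.
  exact: (measurableT_comp mf (measurable_vectorP gW.1)).
rewrite -(@ge0_integral_gaussian (fun z => `|f z|%E))//.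
exact: measurableT_comp.
Qed.

End VectorSigmaAlgebra.
Arguments borel_vector : clear implicits.

(** * A Borel version of the gradient *)

Section GradientApproximation.
Context {R : realType} {d : nat}.
Implicit Types (g : 'cV[R]_d -> R) (z : 'cV[R]_d).

Definition grid m z : 'cV[R]_d :=
  \col_i ((Num.floor (z i 0 * m.+1%:R ^+ 2))%:~R / m.+1%:R ^+ 2).

(* The mesh of the grid is negligible compared with the increment, so that
   this converges to the partial derivative wherever g is differentiable,
   although [grid_quotient g i m] is measurable for every g: it takes
   countably many values. *)
Definition grid_quotient g (i : 'I_d) m z : R :=
  m.+1%:R * (g (grid m z + m.+1%:R^-1 *: delta_mx i 0) - g (grid m z)).

(** The composite is constant on each grid cell, a product of half-open intervals. Cells are indexed
    by integer vectors, so any preimage is a countable union of boxes, whatever [F] is. *)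
Lemma measurable_grid_comp m (F : 'cV[R]_d -> R) :
  measurable_fun setT ((fun z => F (grid m z)) : borel_vector R d -> R).
Proof.
pose M : R := m.+1%:R ^+ 2.
have M0 : 0 < M by rewrite exprn_gt0.
pose ofint (k : 'cV[int]_d) : 'cV[R]_d := \col_i ((k i 0)%:~R / M).
pose cell (k : 'cV[int]_d) : set (borel_vector R d) :=
  [set z | forall i, Num.floor (z i 0 * M) = k i 0].
have mcell k : measurable (cell k).
  apply: sub_sigma_algebra.
  exists (fun i => `[(k i 0)%:~R / M, (k i 0 + 1)%:~R / M[%classic).
  split=> [i|]; first exact: measurable_itv.
  apply/seteqP; split=> z kz i; have := kz i.
    move=> /eqP; rewrite floor_eq => /andP[h1 h2].
    by rewrite /= in_itv/= ler_pdivrMr// ltr_pdivlMr// h1.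
  rewrite /= in_itv/= ler_pdivrMr// ltr_pdivlMr// => h.
  by apply/eqP; rewrite floor_eq.
move=> _ Y mY; rewrite setTI.
rewrite (_ : _ @^-1` _ = \bigcup_(k : 'cV[int]_d)
    (if `[< Y (F (ofint k)) >] then cell k else set0)).
  apply: countable_bigcupT_measurable => [|k]; first exact: countableP.
  by case: ifP.
apply/seteqP; split=> [z Yz|z [k _]].
  exists (\col_i Num.floor (z i 0 * M)) => //=.
  rewrite ifT; first by move=> i; rewrite mxE.
  apply/asboolP; rewrite (_ : ofint _ = grid m z)//.
  by apply/colP => i; rewrite !mxE.
case: asboolP => // Yk kz /=.
rewrite (_ : grid m z = ofint k)//.
by apply/colP => i; rewrite !mxE kz.
Qed.

Lemma measurable_grid_quotient g i m :
  measurable_fun setT (grid_quotient g i m : borel_vector R d -> R).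
Proof.
exact: (measurable_grid_comp m
  (fun z => m.+1%:R * (g (z + m.+1%:R^-1 *: delta_mx i 0) - g z))).
Qed.

Lemma mx_norm_le (z : 'cV[R]_d) (e : R) : 0 <= e ->
  (forall i, `|z i 0| <= e) -> `|z| <= e.
Proof.
move=> e0 ze; rewrite /Num.Def.normr/= mx_normrE.
by apply: bigmax_le => // -[i j] _ /=; rewrite (ord1 j).
Qed.

Lemma grid_dist m z : `|grid m z - z| <= (m.+1%:R ^+ 2)^-1.
Proof.
have M0 : 0 < (m.+1%:R ^+ 2 : R) by rewrite exprn_gt0.
apply: mx_norm_le => [|i]; first by rewrite invr_ge0 ltW.
rewrite !mxE; set M := _ ^+ 2 in M0 *.
have -> : (Num.floor (z i 0 * M))%:~R / M - z i 0 =
    ((Num.floor (z i 0 * M))%:~R - z i 0 * M) / M.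
  by rewrite mulrBl mulfK// gt_eqF.
rewrite normrM (gtr0_norm (_ : 0 < M^-1)) ?invr_gt0//.
apply: ler_piMl; first by rewrite invr_ge0 ltW.
have /andP[h1] := floor_itv (z i 0 * M); rewrite intrD => h2.
by rewrite ler_norml; apply/andP; split; lra.
Qed.

Lemma norm_delta_mx_le1 (i : 'I_d) : `|delta_mx i 0 : 'cV[R]_d| <= 1.
Proof.
apply: mx_norm_le => // k; rewrite mxE andbT.
by case: eqP; rewrite ?normr1 ?normr0.
Qed.

(** Both evaluation points are within [2 * u] of [z], where [u] is the increment, so the first-order
    remainders of [g] at [z] are small relative to [u] and survive division by it. *)
Lemma cvg_grid_quotient g i z : differentiable g z ->
  grid_quotient g i m z @[m --> \oo] --> grad g z i 0.
Proof.
move=> dg; have := diff_locally dg => /eqaddoP small.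
have -> : grad g z i 0 = 'd g z (delta_mx i 0) by rewrite mxE deriveE.
apply/cvgrPdist_le => e e0.
(* The two remainders will be bounded by [e / 3 * u] and [e / 3 * (2 * u)], with sum [e * u]. *)
have e3 : 0 < e / 3 by rewrite divr_gt0.
have /nbhs_normP[r r0 rP] := small _ e3.
have /cvgrPdist_lt/(_ (r / 2)) := @cvg_harmonic R.
rewrite divr_gt0// => /(_ isT) hr; near=> m.
pose u : R := m.+1%:R^-1.
have u0 : 0 < u by rewrite invr_gt0.
have u1 : u <= 1 by rewrite invf_le1// ler1n.
have u2 : u * u <= u by apply: ler_piMl => //; exact: ltW.
have ur : u < r / 2.
  have : `|0 - harmonic m| < r / 2 by near: m.
  by rewrite sub0r normrN gtr0_norm.
pose h2 := grid m z - z; pose h1 := h2 + u *: delta_mx i 0.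
have nh2 : `|h2| <= u * u by rewrite -expr2 /u exprVn; exact: grid_dist.
have nh1 : `|h1| <= 2 * u.
  rewrite (le_trans (ler_normD _ _))// normrZ (gtr0_norm u0).
  have : u * `|delta_mx i 0 : 'cV[R]_d| <= u.
    by apply: ler_piMr (norm_delta_mx_le1 i); exact: ltW.
  by lra.
have rem h : `|h| < r -> `|g (h + z) - (g z + 'd g z h)| <= e / 3 * `|h|.
  by move=> hlt; have := rP h; rewrite /ball_/= sub0r normrN; apply.
have := rem h1; have := rem h2.
have -> : h2 + z = grid m z by rewrite subrK.
have -> : h1 + z = grid m z + u *: delta_mx i 0 by rewrite addrAC subrK.
have -> : 'd g z h1 = 'd g z h2 + u * 'd g z (delta_mx i 0).
  by rewrite [LHS]linearD [X in _ + X = _]linearZ.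
set D := 'd g z (delta_mx i 0); set G2 := g (grid m z); set G1 := g (grid m z + _); set D2 := 'd g z h2.
move=> r2 r1.
have {}r2 : `|G2 - (g z + D2)| <= e / 3 * u.
  apply: (le_trans (r2 _)); first by lra.
  by apply: ler_wpM2l; [exact: ltW|exact: le_trans nh2 u2].
have {}r1 : `|G1 - (g z + (D2 + u * D))| <= e / 3 * (2 * u).
  apply: (le_trans (r1 _)); first by lra.
  by apply: ler_wpM2l => //; exact: ltW.
(* The error of the quotient is the difference of the two remainders divided by [u]: the terms [g z]
   and [D2] cancel. *)
have -> : D - m.+1%:R * (G1 - G2) =
    m.+1%:R * ((G2 - (g z + D2)) - (G1 - (g z + (D2 + u * D)))).
  have mu1 : m.+1%:R * u = 1 by rewrite mulfV.
  transitivity (m.+1%:R * u * D - m.+1%:R * (G1 - G2)); last by ring.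
  by rewrite mu1 mul1r.
rewrite normrM normr_nat -ler_pdivlMl// -/u.
by apply: (le_trans (ler_normB _ _)); lra.
Unshelve. all: by end_near.
Qed.

End GradientApproximation.

(** * Gradients, drift equations and IS integrands under orthogonal substitution *)

Section ChainRule.
Context {R : realType} {d : nat}.
Implicit Types (g : 'cV[R]_d -> R) (U : 'M[R]_d) (z mu : 'cV[R]_d).

Lemma differentiable_mulmx U z : differentiable (mulmx U : 'cV[R]_d -> 'cV[R]_d) z.
Proof.
rewrite (_ : mulmx U = \sum_(k < d) (fun v : 'cV[R]_d => v k 0 *: col k U)).
  apply: differentiable_sum => k; apply: differentiableZl.
  exact: differentiable_coord.
apply/funext => v; rewrite fct_sumE; apply/colP => i.
rewrite mxE summxE; apply: eq_bigr => k _.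
by rewrite !mxE mulrC.
Qed.

Lemma diff_mulmx U z : 'd (mulmx U : 'cV[R]_d -> 'cV[R]_d) z = mulmx U :> ('cV[R]_d -> 'cV[R]_d).
Proof.
apply: diff_lin => v; apply: differentiable_continuous.
exact: differentiable_mulmx.
Qed.

Lemma differentiable_comp_mulmx g U z : differentiable g (U *m z) ->
  differentiable (fun v => g (U *m v)) z.
Proof.
by move=> dg; apply: (@differentiable_comp _ _ _ _ (mulmx U) g) => //; exact: differentiable_mulmx.
Qed.

Lemma grad_comp_mulmx g U z : differentiable g (U *m z) ->
  grad (fun v => g (U *m v)) z = U^T *m grad g (U *m z).
Proof.
move=> dg; apply/colP => i; rewrite !mxE deriveE; last exact: differentiable_comp_mulmx.
rewrite (_ : (fun v => g (U *m v)) = g \o mulmx U)// diff_comp//; last exact: differentiable_mulmx.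
rewrite /= diff_mulmx.
(* The direction is column [i] of [U]; expanding it in the standard basis turns the differential
   into a combination of partial derivatives. *)
have -> : U *m delta_mx i 0 = \sum_k U k i *: (delta_mx k 0 : 'cV[R]_d).
  apply/colP => j; rewrite summxE (bigD1 j)//= big1 ?addr0.
    rewrite mxE (bigD1 i)//= big1 ?addr0 => [|k ki]; first by rewrite !mxE !eqxx.
    by rewrite mxE (negbTE ki) mulr0.
  by move=> k kj; rewrite !mxE eq_sym (negbTE kj) mulr0.
rewrite linear_sum; apply: eq_bigr => k _.
by rewrite linearZ/= !mxE deriveE.
Qed.

Lemma differentiable_IS_integrand g mu z : differentiable g (z + mu) ->
  differentiable (IS_integrand g mu) z.
Proof.
move=> dg; apply: differentiableM.
  apply: (@differentiable_comp _ _ _ _ ((id : 'cV[R]_d -> 'cV[R]_d) + cst mu) g) => //.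
apply: (@differentiable_comp _ _ _ _
  (- (fun v => (mu^T *m v) 0 0) - cst ((mu^T *m mu) 0 0 / 2)) expR).
  apply: differentiableB => //; apply: differentiableN.
  rewrite (_ : (fun v : 'cV[R]_d => (mu^T *m v) 0 0) =
               \sum_(k < d) (fun v : 'cV[R]_d => mu k 0 * v k 0)).
    apply: differentiable_sum => k; apply: differentiableM => //.
    exact: differentiable_coord.
  apply/funext => v; rewrite fct_sumE mxE; apply: eq_bigr => k _.
  by rewrite mxE.
by apply/derivable1_diffP; exact: derivable_expR.
Qed.

Lemma orthogonal_mxK U : orthogonal_mx U -> U *m U^T = 1%:M.
Proof. exact: mulmx1C. Qed.

(** Since [U] sends [U^T *m mu] back to [mu], the new equation is the old one multiplied by
    [U^T]. *)
Lemma solves_opt_drift_eq_comp g U mu : orthogonal_mx U ->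
  solves_opt_drift_eq g mu ->
  solves_opt_drift_eq (fun z => g (U *m z)) (U^T *m mu).
Proof.
move=> oU [dg [g0 gmu]].
have Umu : U *m (U^T *m mu) = mu by rewrite mulmxA orthogonal_mxK// mul1mx.
split; first by apply: differentiable_comp_mulmx; rewrite Umu.
rewrite Umu; split => //.
by rewrite grad_comp_mulmx Umu// -linearZ/= gmu.
Qed.

(** The linear term in the exponent moves [U] onto [z], and the quadratic term is unchanged because
    [U^T] preserves norms. *)
Lemma IS_integrand_comp g U mu z : orthogonal_mx U ->
  IS_integrand (fun v => g (U *m v)) (U^T *m mu) z = IS_integrand g mu (U *m z).
Proof.
move=> oU; rewrite /IS_integrand mulmxDr mulmxA orthogonal_mxK// mul1mx.
by rewrite trmx_mul trmxK -!mulmxA (mulmxA U) orthogonal_mxK// mul1mx.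
Qed.

End ChainRule.

Section BorelGradient.
Context {R : realType} {d : nat}.
Implicit Type h : 'cV[R]_d -> R.

(** An upper limit is measurable without any convergence; [fine] sends infinite values to 0, which
    can occur only where [h] is not differentiable. *)
Definition borel_grad h (i : 'I_d) (z : borel_vector R d) : R :=
  fine (limn_esup (fun m => (grid_quotient h i m z)%:E)).

Lemma measurable_borel_grad h i : measurable_fun setT (borel_grad h i).
Proof.
apply: (@measurableT_comp _ _ _ _ _ _ fine) => //.
apply: measurable_fun_limn_esup => m; apply/measurable_EFinP.
exact: measurable_grid_quotient.
Qed.

Lemma borel_gradE h i z : differentiable h z -> borel_grad h i z = grad h z i 0.
Proof.
move=> dh; rewrite /borel_grad.
have /cvg_limn_einf_sup[_ ->//] :
    (grid_quotient h i m z)%:E @[m --> \oo] --> (grad h z i 0)%:E.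
by apply: cvg_EFin; [exact: nearW|exact: cvg_grid_quotient].
Qed.

End BorelGradient.

(** * The gradient information matrix under orthogonal substitution *)

Section GradientInformation.
Context {dT : measure_display} {T : measurableType dT} {R : realType} {d : nat}.
Variable P : probability T R.

Lemma negligible_ae_eq (N : set T) (f g : T -> \bar R) : P.-negligible N ->
  (forall w, ~ N w -> f w = g w) -> ae_eq P setT f g.
Proof.
move=> nN fg; apply: (negligibleS _ nN) => w /= nfg.
by apply: contrapT => Nw; apply: nfg => _; exact: fg.
Qed.

Lemma integrable_ae_eq (f g : T -> \bar R) : measurable_fun setT g ->
  ae_eq P setT f g -> P.-integrable setT f -> P.-integrable setT g.
Proof.
move=> mg fg /integrableP[mf foo]; apply/integrableP; split => //.
have <- : (\int[P]_w `|f w| = \int[P]_w `|g w|)%E.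
  apply: ae_eq_integral => //; [exact: measurableT_comp..|exact: (ae_eq_abse fg)].
exact: foo.
Qed.

(** Gradients are replaced by [borel_grad] outside two null events, one for [Z] and one for
    [U *m Z]; the chain rule then expands each entry as a double sum, and invariance of the law acts
    term by term. *)
Lemma grad_info_mx_comp (Z : T -> 'cV[R]_d) (h : 'cV[R]_d -> R) (U : 'M[R]_d) :
  std_gaussian_vector P Z -> orthogonal_mx U ->
  P.-negligible [set w | ~ differentiable h (Z w)] ->
  P.-negligible [set w | ~ differentiable h (U *m Z w)] ->
  gim_finite P Z h -> gim_finite P Z (fun z => h (U *m z)) ->
  grad_info_mx P Z (fun z => h (U *m z)) = U^T *m grad_info_mx P Z h *m U.
Proof.
move=> gZ oU nZ nW iZ iUZ.
pose W w := U *m Z w.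
have gW : std_gaussian_vector P W := std_gaussian_orthogonal oU gZ.
pose B k l (z : borel_vector R d) := (borel_grad h k z * borel_grad h l z)%:E.
have mB k l : measurable_fun setT (B k l).
  by apply/measurable_EFinP; apply: measurable_funM; exact: measurable_borel_grad.
have mBZ k l : measurable_fun setT (fun w => B k l (Z w)).
  exact: (measurableT_comp (mB k l) (measurable_vectorP gZ.1)).
have aeZ k l : ae_eq P setT
    (fun w => (grad h (Z w) k 0 * grad h (Z w) l 0)%:E) (fun w => B k l (Z w)).
  apply: (negligible_ae_eq nZ) => w /contrapT dw.
  by rewrite /B !borel_gradE.
have iBZ k l : P.-integrable setT (fun w => B k l (Z w)).
  exact: (integrable_ae_eq (mBZ k l) (aeZ k l) (iZ k l)).
have iBW k l : P.-integrable setT (fun w => B k l (W w)).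
  exact: (integrable_gaussian gZ gW (mB k l) (iBZ k l)).
(* The passage from [U *m Z] back to [Z]: equality of laws for the Borel function [B], then return
   to the true gradient almost everywhere. *)
have intW k l : (\int[P]_w B k l (W w) =
    \int[P]_w (grad h (Z w) k 0 * grad h (Z w) l 0)%:E)%E.
  rewrite -(integral_gaussian gZ gW (mB k l)); apply: ae_eq_integral => //.
    by have /integrableP[] := iZ k l.
  exact: ae_eq_sym.
apply/matrixP => i j.
pose F k l w := ((U k i * U l j)%:E * B k l (W w))%E.
have iF k l : P.-integrable setT (F k l) by exact: integrableZl.
rewrite mxE unlock.
have -> : (\int[P]_w (grad (fun z => h (U *m z)) (Z w) i 0 *
      grad (fun z => h (U *m z)) (Z w) j 0)%:E =
    \int[P]_w \sum_k \sum_l F k l w)%E.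
  apply: ae_eq_integral => //.
  - by have /integrableP[] := iUZ i j.
  - apply: emeasurable_sum => k; apply: emeasurable_sum => l.
    by have /integrableP[] := iF k l.
  - apply: (negligible_ae_eq nW) => w /contrapT dw.
    rewrite grad_comp_mulmx// !mxE big_distrl -sumEFin; apply: eq_bigr => k _ /=.
    rewrite big_distrr -sumEFin; apply: eq_bigr => l _ /=.
    rewrite /F /B !borel_gradE// -EFinM; congr EFin.
    by rewrite !mxE; ring.
rewrite integral_sum// => [|k]; last exact: integrable_sum.
(* [fine] is additive only on finite values, which integrability of the terms provides. *)
rewrite -sum_fine => [|k _]; last first.
  by apply: integrable_fin_num => //; exact: integrable_sum.
rewrite -mulmxA mxE; apply: eq_bigr => k _.
rewrite integral_sum// -sum_fine => [|l _]; last exact: integrable_fin_num.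
rewrite !mxE big_distrr; apply: eq_bigr => l _ /=.
rewrite /F integralZl// fineM//; last by apply: integrable_fin_num.
by rewrite intW mxE unlock /=; ring.
Qed.

End GradientInformation.

Unset Implicit Arguments.
Set Strict Implicit.
Set Printing Implicit Defensive.

Theorem theorem3p5 (R : realType) (d : nat)
  (dT : measure_display) (T : measurableType dT) (P : probability T R)
  (Z : T -> 'cV[R]_d) (g1 : 'cV[R]_d -> R) (U : 'M[R]_d) (mu1 mu2 : 'cV[R]_d) :
  std_gaussian_vector P Z ->
  (forall z, 0 <= g1 z) ->
  differentiable_ae g1 ->
  orthogonal_mx U ->
  (forall mu, solves_opt_drift_eq g1 mu <-> mu = mu1) ->
  (forall mu, solves_opt_drift_eq (fun z => g1 (U *m z)) mu <-> mu = mu2) ->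
  gim_finite P Z (IS_integrand g1 mu1) ->
  gim_finite P Z (IS_integrand (fun z => g1 (U *m z)) mu2) ->
  let g2 := fun z => g1 (U *m z) in
  let g1I := IS_integrand g1 mu1 in
  let g2I := IS_integrand g2 mu2 in
  let C1 := grad_info_mx P Z g1I in
  let C2 := grad_info_mx P Z g2I in
  exists V : 'M[R]_d,
    orthogonal_mx V /\
    (forall z, g2I z = g1I (V *m z)) /\
    C2 = V^T *m C1 *m V /\
    (forall (Q1 : 'M[R]_d) (lam : 'rV[R]_d), eigendecomp C1 Q1 lam ->
       eigendecomp C2 (V^T *m Q1) lam /\
       (forall r, active_subspace (V^T *m Q1) r = (fun x => V^T *m x) @` active_subspace Q1 r) /\
       (forall z, IA_integrand g1I Q1 z = IA_integrand g2I (V^T *m Q1) z)).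
Proof.
move=> gZ _ [N [nullN diffN]] oU sol1 sol2 fin1 fin2 g2 g1I g2I C1 C2.
have mu2E : mu2 = U^T *m mu1.
  by apply/esym/sol2; apply: solves_opt_drift_eq_comp => //; exact/sol1.
have g2IE : g2I = fun z => g1I (U *m z).
  by apply/funext => z; rewrite /g2I mu2E; exact: IS_integrand_comp.
(* Stated for every Gaussian [Y] because it serves twice: at [Z] for [C1], and at [U *m Z] for the
   chain rule behind [C2]. *)
have diff_null Y : std_gaussian_vector P Y ->
    P.-negligible [set w | ~ differentiable g1I (Y w)].
  move=> gY; apply: negligibleS (negligible_lebesgue_null gY mu1 nullN) => w /= ndY.
  apply: contrapT => NY; apply: ndY.
  by apply: differentiable_IS_integrand; exact: diffN.
have UUt := orthogonal_mxK oU.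
have C2E : C2 = U^T *m C1 *m U.
  have fin2' : gim_finite P Z (fun z => g1I (U *m z)) by rewrite -g2IE.
  rewrite /C2 g2IE; exact: (grad_info_mx_comp gZ oU (diff_null Z gZ)
    (diff_null _ (std_gaussian_orthogonal oU gZ)) fin1 fin2').
exists U; split=> //; split; first by move=> z; rewrite g2IE.
split=> // Q1 lam [oQ [C1E lam_sorted]]; split; [|split].
- split; first by rewrite /orthogonal_mx trmx_mul trmxK -mulmxA (mulmxA U) UUt mul1mx.
  by split=> //; rewrite C2E C1E trmx_mul trmxK !mulmxA.
(* The same coefficient vector [c] represents a point of one subspace and its image in the other. *)
- move=> r; apply/seteqP; split.
    move=> _ [c [c0 ->]]; exists (Q1 *m c); first by exists c.
    by rewrite mulmxA.
  by move=> _ [_ [c [c0 ->]] <-]; exists c; rewrite mulmxA.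
- by move=> z; rewrite /IA_integrand g2IE -mulmxA mulmxA UUt mul1mx.
Qed.
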